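(* Given a natural number $n\lesssim q$, and elements $\alpha,\beta\in\mathbb{F}_q^*$, there is a set $E\subset\mathbb{F}_q^2$ for which $|E|=n$ and $$|\Pi_{\alpha,\beta}(E)|\approx n^2 .$$
   Context: $\mathbb{F}_q$ is the finite field with $q$ elements, $\mathbb{F}_q^*=\mathbb{F}_q\setminus\{0\}$, $\mathbb{F}_q^2$ is the $2$-dimensional vector space over $\mathbb{F}_q$, and for $x,y\in\mathbb{F}_q^2$, $x\cdot y=x_1y_1+x_2y_2$ is the dot product. For $E\subset\mathbb{F}_q^2$ and $\alpha,\beta\in\mathbb{F}_q$, $$\Pi_{\alpha,\beta}(E)=\{(x,y,z)\in E\times E\times E : x\cdot y=\alpha,\ x\cdot z=\beta\}.$$ The notation $X\lesssim Y$ means that $X\le cY$ for some constant $c>0$; $X\gtrsim Y$ means $Y\lesssim X$; and $X\approx Y$ means that both $X\lesssim Y$ and $X\gtrsim Y$ hold.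
   Formalization: The formal theorem also assumes n ≤ q² (otherwise no subset of size n exists) and, when n = 1, that α = β (for n = 1 and α ≠ β the set Π is empty, so the claim fails). *)

(* Defs.v *)
From HB Require Import structures.
From mathcomp Require Import all_boot all_order all_algebra.

Set Implicit Arguments.
Unset Strict Implicit.
Unset Printing Implicit Defensive.

Import Order.TTheory GRing.Theory Num.Theory.
Local Open Scope ring_scope.

(* The constant c is an explicit argument, so that statements can quantify it
   before the field and the other varying parameters. *)
Definition lesssim (R : realFieldType) (c X Y : R) : Prop := X <= c * Y.

Definition dot2 (F : finFieldType) (x y : 'rV[F]_2) : F :=
  \sum_(i < 2) x 0 i * y 0 i.

Definition Pi_dot (F : finFieldType) (alpha beta : F) (E : {set 'rV[F]_2}) :
    {set 'rV[F]_2 * 'rV[F]_2 * 'rV[F]_2} :=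
  [set t | let: (x, y, z) := t in
    [&& x \in E, y \in E, z \in E, dot2 x y == alpha & dot2 x z == beta]].

(* Main.v *)
(** For the upper bound, split the triples [(x, y, z)] according to whether
    [beta *: y = alpha *: z].  If so, [z] is determined by [y]; if not, [y] and
    [z] are linearly independent, so [x] is determined by [(y, z)].  Hence
    every [E] has at most [2 * #|E| ^ 2] triples.  For the lower bound, choose
    [x] with [x . x = beta], which is possible because every element of a
    finite field is a sum of two squares, and let [E] contain [k] points of
    each of the lines [x . y = alpha] and [x . z = beta], the point [x] being
    one of the latter, where [k] is comparable to [n]. *)
Require Import Defs.
From HB Require Import structures.
From mathcomp Require Import all_boot all_order all_algebra.
From mathcomp Require Import ring lra zify.
Import Order.TTheory GRing.Theory Num.Theory.
Local Open Scope ring_scope.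

(** Used both to pick exactly [k] points of a line and to pad a configuration to exactly [n]
    points. *)
Lemma exists_set_between (T : finType) (U V : {set T}) (n : nat) :
  U \subset V -> (#|U| <= n <= #|V|)%N ->
  exists W : {set T}, [/\ U \subset W, W \subset V & #|W| = n].
Proof.
move=> sUV /andP[]; elim: n => [|n IHn].
  by rewrite leqn0 cards_eq0 => /eqP-> _; exists set0; rewrite !sub0set cards0.
rewrite leq_eqVlt => /orP[/eqP cU _|ltUn ltnV].
  by exists U; split.
have [W [sUW sWV cW]] := IHn ltUn (ltnW ltnV).
have /properP[_ [a aV aW]] : W \proper V by rewrite properEcard sWV cW.
exists (a |: W); split; last by rewrite cardsU1 aW cW.
  exact: subset_trans sUW (subsetUr _ _).
by apply/subsetP=> b /setU1P[->//|]; apply: (subsetP sWV).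
Qed.

(** Each fibre of squaring lies in some [[set t; - t]], and the fibre over 0 is a single point,
    which makes the inequality strict. *)
Lemma card_squares (F : finFieldType) :
  (#|F| < 2 * #|[set t ^+ 2 | t : F]|)%N.
Proof.
set S := [set _ | t : F].
have S0 : 0 \in S by apply/imsetP; exists 0; rewrite ?expr0n.
have -> : #|F| = (\sum_(s in S) #|[set t : F | t ^+ 2 == s]|)%N.
  rewrite -sum1_card (partition_big_imset (fun t : F => t ^+ 2)) /=.
  have -> : [set t ^+ 2 | t in F] = S by [].
  by apply: eq_bigr => s _; rewrite -sum1dep_card.
rewrite (big_setD1 0 S0) /= (cardsD1 0 S) S0.
have -> : [set t : F | t ^+ 2 == 0] = [set 0].
  by apply/setP=> t; rewrite !inE sqrf_eq0.
rewrite cards1 mulnDr muln1 ltnS leq_add2l mulnC -sum_nat_const.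
apply: leq_sum => _ /setD1P[_ /imsetP[t _ ->]].
apply: (@leq_trans #|[set t; - t]|); last by rewrite cards2; case: eqP.
by apply/subset_leq_card/subsetP=> u; rewrite !inE eqf_sqr.
Qed.

(** The squares [S] and their reflection [c - S] each fill more than half of the field, so they
    meet. *)
Lemma sum_two_squares (F : finFieldType) (c : F) :
  exists a b : F, a ^+ 2 + b ^+ 2 = c.
Proof.
pose S := [set t ^+ 2 | t : F]; pose S' := [set c - s | s in S].
have cS' : #|S'| = #|S| by apply: card_imset => x y /addrI/oppr_inj.
have : (0 < #|S :&: S'|)%N.
  rewrite -(ltn_add2l #|S :|: S'|) addn0 cardsUI cS' addnn -mul2n.
  exact: leq_ltn_trans (max_card _) (card_squares F).
case/card_gt0P=> _ /setIP[/imsetP[a _ ->] /imsetP[_ /imsetP[b _ ->] ab]].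
by exists a, b; rewrite ab subrK.
Qed.

Section Dot2.
Variable F : finFieldType.
Implicit Types (x y z : 'rV[F]_2) (E : {set 'rV[F]_2}).

Lemma dot2E x y : dot2 x y = x 0 0 * y 0 0 + x 0 1 * y 0 1.
Proof.
rewrite /dot2 !big_ord_recl big_ord0 addr0; congr (_ + _ * _); congr (_ _ _);
  exact/val_inj.
Qed.

Lemma row2P x y : x 0 0 = y 0 0 -> x 0 1 = y 0 1 -> x = y.
Proof.
move=> e0 e1; apply/rowP; case=> -[|[|//]] lt.
  by rewrite (_ : Ordinal lt = 0) //; apply/val_inj.
by rewrite (_ : Ordinal lt = 1) //; apply/val_inj.
Qed.

(** Cramer's rule, with [d] the determinant of [y] and [z]. The coordinates of [b *: y - a *: z] are
    [x 0 1 * d] and [- x 0 0 * d], so [d] cannot vanish. *)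
Lemma dot2_inj (a b : F) x x' y z :
  dot2 x y = a -> dot2 x z = b -> dot2 x' y = a -> dot2 x' z = b ->
  b *: y != a *: z -> x = x'.
Proof.
rewrite !dot2E => xy xz x'y x'z neq.
set d := y 0 0 * z 0 1 - y 0 1 * z 0 0.
have d0 : d != 0.
  apply: contraNneq neq => d0; apply/eqP/row2P; rewrite !mxE -xy -xz.
    by apply/eqP; rewrite -subr_eq0 -(mulr0 (x 0 1)) -d0 /d; apply/eqP; ring.
  by apply/eqP; rewrite -subr_eq0 -(mulr0 (- x 0 0)) -d0 /d; apply/eqP; ring.
apply: row2P; apply: (mulIf d0).
  have -> : x 0 0 * d = z 0 1 * a - y 0 1 * b by rewrite -xy -xz /d; ring.
  by rewrite -x'y -x'z /d; ring.
have -> : x 0 1 * d = y 0 0 * b - z 0 0 * a by rewrite -xy -xz /d; ring.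
by rewrite -x'y -x'z /d; ring.
Qed.

Lemma card_Pi_dot_le (a b : F) E : a != 0 ->
  (#|Pi_dot a b E| <= 2 * #|E| ^ 2)%N.
Proof.
move=> a0; set P := Pi_dot a b E.
pose D := [set t : 'rV[F]_2 * 'rV[F]_2 * 'rV[F]_2 | b *: t.1.2 == a *: t.2].
rewrite -(cardsID D P) mul2n -addnn expnS expn1 -cardsX.
apply: leq_add.
  pose f (t : 'rV[F]_2 * 'rV[F]_2 * 'rV[F]_2) := t.1.
  rewrite -(card_in_imset (f := f)); last first.
    move=> [[x y] z] [[x' y'] z'] /setIP[_ +] /setIP[_ +] [ex ey].
    rewrite !inE /= ex ey => /eqP-> /eqP e.
    by congr (_, _); apply: (scalerI a0).
  apply/subset_leq_card/subsetP=> _ /imsetP[[[x y] z] /setIP[+ _] ->].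
  by rewrite !inE => /and5P[-> ->].
pose f (t : 'rV[F]_2 * 'rV[F]_2 * 'rV[F]_2) := (t.1.2, t.2).
rewrite -(card_in_imset (f := f)); last first.
  move=> [[x y] z] [[x' y'] z'] /setDP[+ +] /setDP[+ _] [ey ez].
  rewrite !inE /= -ey -ez => /and5P[_ _ _ /eqP xy /eqP xz] neq.
  move=> /and5P[_ _ _ /eqP x'y /eqP x'z].
  by rewrite (dot2_inj _ _ _ _ _ _ xy xz x'y x'z neq).
apply/subset_leq_card/subsetP=> _ /imsetP[[[x y] z] /setDP[+ _] ->].
by rewrite !inE => /and5P[_ -> ->].
Qed.

Lemma card_dot2_line (c : F) x : x != 0 ->
  (#|F| <= #|[set y | dot2 x y == c]|)%N.
Proof.
move=> x0.
have [p xp] : exists p, dot2 x p = c.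
  have [x00|x00] := eqVneq (x 0 0) 0; last first.
    exists (\row_i if i == 0 then c / x 0 0 else 0).
    by rewrite dot2E !mxE /= mulr0 addr0 mulrC divfK.
  have x01 : x 0 1 != 0.
    by apply: contraNneq x0 => x01; apply/eqP/row2P; rewrite mxE.
  exists (\row_i if i == 0 then 0 else c / x 0 1).
  by rewrite dot2E !mxE /= mulr0 add0r mulrC divfK.
(* [r] is orthogonal to [x], so [t] maps to [p + t *: r] injectively into the line. *)
pose r := \row_i (if i == 0 then - x 0 1 else x 0 0) : 'rV[F]_2.
have r0 : r != 0.
  apply: contraNneq x0 => r0; apply/eqP/row2P; rewrite mxE.
    by have := congr1 (fun u : 'rV[F]_2 => u 0 1) r0; rewrite !mxE.
  have /eqP := congr1 (fun u : 'rV[F]_2 => u 0 0) r0.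
  by rewrite !mxE /= oppr_eq0 => /eqP.
rewrite -(card_imset (f := fun t => p + t *: r) F); last first.
  move=> s t /addrI/eqP; rewrite -subr_eq0 -scalerBl scaler_eq0 (negPf r0) orbF.
  by rewrite subr_eq0 => /eqP.
apply/subset_leq_card/subsetP=> _ /imsetP[t _ ->]; rewrite inE -xp !dot2E.
by rewrite !mxE /=; apply/eqP; ring.
Qed.

Lemma card_Pi_dot_ge (a b : F) x (A B E : {set 'rV[F]_2}) :
  x \in E -> A \subset E -> B \subset E ->
  A \subset [set y | dot2 x y == a] -> B \subset [set z | dot2 x z == b] ->
  (#|A| * #|B| <= #|Pi_dot a b E|)%N.
Proof.
move=> xE /subsetP sAE /subsetP sBE /subsetP sAa /subsetP sBb.
have <- : #|setX (setX [set x] A) B| = (#|A| * #|B|)%N.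
  by rewrite !cardsX cards1 mul1n.
apply/subset_leq_card/subsetP=> -[[x' y] z].
rewrite !inE /= => /andP[/andP[/eqP-> yA] zB].
rewrite xE sAE ?sBE //=.
by have := sAa y yA; have := sBb z zB; rewrite !inE => -> ->.
Qed.

(** Since [x . x = b], the point [x] is itself one of the [k] points of [B], so [2 * k] points
    suffice for [x], [A] and [B] together. *)
Lemma exists_Pi_dot_ge (n k : nat) (a b : F) : b != 0 ->
  (n <= #|F| ^ 2)%N -> (0 < k <= #|F|)%N ->
  (2 * k <= n)%N || (n == 1%N) && (k == 1%N) && (a == b) ->
  exists2 E : {set 'rV[F]_2}, #|E| = n & (k ^ 2 <= #|Pi_dot a b E|)%N.
Proof.
move=> b0 nF /andP[k0 kF] kn.
have [c [d cd]] := sum_two_squares F b.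
pose x := \row_i (if i == 0 then c else d) : 'rV[F]_2.
have xx : dot2 x x = b by rewrite dot2E !mxE -cd.
have x0 : x != 0.
  by apply: contraNneq b0 => x0; rewrite -xx x0 dot2E !mxE !mulr0 addr0.
have line e : (k <= #|[set y | dot2 x y == e]|)%N.
  exact: leq_trans kF (card_dot2_line e x x0).
have [||B [/subsetP xB sB cB]] :=
    @exists_set_between _ [set x] [set z | dot2 x z == b] k.
- by rewrite sub1set inE xx.
- by rewrite cards1 k0 line.
have {}xB : x \in B by apply: xB; rewrite inE.
have [A [sA cA cAB]] : exists A : {set 'rV[F]_2},
    [/\ A \subset [set y | dot2 x y == a], #|A| = k & (#|A :|: B| <= n)%N].
  case/orP: kn => [kn|/andP[/andP[/eqP-> /eqP k1] /eqP->]]; last first.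
    (* Here [a = b], so the two lines coincide and [B] serves for both. *)
    by exists B; rewrite setUid cB k1.
  have [||A [_ sA cA]] := @exists_set_between _ set0 [set y | dot2 x y == a] k.
  - exact: sub0set.
  - by rewrite cards0 line.
  exists A; split=> //; apply: leq_trans kn.
  by rewrite mul2n -addnn -{1}cA -cB -cardsUI leq_addr.
have [||E [sE _ cE]] := @exists_set_between _ (A :|: B) setT n.
- exact: subsetT.
- by rewrite cAB cardsT card_mx mul1n.
exists E => //; rewrite expnS expn1 -{1}cA -cB.
move: sE; rewrite subUset => /andP[sAE sBE].
by apply: (@card_Pi_dot_ge _ _ x) => //; apply: (subsetP sBE).
Qed.

End Dot2.

(** The constants depend on [C] alone. A one-point [E] admits a triple only if [alpha = beta],
    whence the condition at [n = 1]; the plane has [#|F| ^ 2] points, whence the bound on [n]. *)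
Theorem proposition9 (R : realFieldType) (C : R) (C_gt0 : 0 < C) :
  exists c1 c2 : R, [/\ 0 < c1, 0 < c2 &
    forall (F : finFieldType) (n : nat) (alpha beta : F),
      lesssim C n%:R #|F|%:R ->
      (n <= #|F| ^ 2)%N ->
      alpha != 0 -> beta != 0 ->
      (n = 1%N -> alpha = beta) ->
      exists E : {set 'rV[F]_2},
        [/\ #|E| = n,
            lesssim c1 #|Pi_dot alpha beta E|%:R (n%:R ^+ 2) &
            lesssim c2 (n%:R ^+ 2) #|Pi_dot alpha beta E|%:R]].
Proof.
have C3 : 0 < 3 + C by lra.
exists 2, ((3 + C) ^+ 2); split; [lra | exact: exprn_gt0 |].
rewrite /lesssim => F n alpha beta nC nF a0 b0 n1.
suff [E cE [k kE nk]] : exists2 E : {set 'rV[F]_2}, #|E| = n &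
    exists2 k, (k ^ 2 <= #|Pi_dot alpha beta E|)%N & n%:R <= (3 + C) * k%:R.
  exists E; split=> //.
    rewrite -natrX -natrM ler_nat -cE; exact: card_Pi_dot_le.
  apply: (@le_trans _ _ (((3 + C) * k%:R) ^+ 2)).
    by apply: lerXn2r => //; rewrite nnegrE ?mulr_ge0 ?ler0n // ltW.
  by rewrite exprMn ler_wpM2l ?sqr_ge0 // -natrX ler_nat.
have [n0|n_gt0] := posnP n.
  by exists set0; [rewrite cards0 n0 | exists 0%N; rewrite // n0 mulr0].
(* Half of [n] for each line, capped by the [#|F|] points that a line is known to have, and kept
   positive when [n = 1]. *)
pose k := minn (maxn 1 n./2) #|F|.
have F_gt0 : (0 < #|F|)%N by apply/card_gt0P; exists 0.
have [||E cE kE] := exists_Pi_dot_ge F n k alpha beta b0 nF.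
- by rewrite /k; lia.
- have [n_eq1|n_neq1] := eqVneq n 1%N; last by rewrite /k; lia.
  by rewrite n1 // eqxx andbT /k n_eq1 /=; lia.
exists E => //; exists k => //.
have k0 : 0 <= k%:R :> R by exact: ler0n.
(* If the cap is attained, [n <= C * #|F|] gives the bound; otherwise rounding costs at most a
   factor 3, reached at [n = 3]. *)
have [kF|nk] : k = #|F| \/ (n <= 3 * k)%N by rewrite /k; lia.
  by apply: le_trans nC _; rewrite kF; rewrite kF in k0; nra.
have : n%:R <= 3 * k%:R :> R by rewrite -natrM ler_nat.
nra.
Qed.
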